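(* Let $d\in\{2,3\}$ and let $p(z)=z^d+a_{d-1}z^{d-1}+\cdots+a_1z+a_0$ be an expanding polynomial with integer coefficients, leading coefficient $1$ and free term $a_0=\pm2$. Let $M$ be the companion matrix of $p$ and let $D=\{\boldsymbol 0,\boldsymbol e\}$, where $\boldsymbol e=(1,0,\ldots,0)^T\in\mathbb{R}^d$. Then the 2-attractor $G(M,D)$ is a tile.
   Context: A polynomial is expanding if all its complex roots have modulus strictly greater than $1$. The companion matrix of $p(z)=z^d+a_{d-1}z^{d-1}+\cdots+a_0$ is the $d\times d$ matrix $M$ with $M_{i+1,i}=1$ for $i=1,\ldots,d-1$, last column $(-a_0,-a_1,\ldots,-a_{d-1})^T$, and all other entries $0$. The 2-attractor generated by $M$ and $D$ is the compact set $G(M,D)=\{\sum_{k=1}^{\infty}M^{-k}\boldsymbol a_k : \boldsymbol a_k\in D \text{ for all } k\}\subset\mathbb{R}^d$. An attractor is called a tile if its Lebesgue measure equals $1$ (equivalently, its integer shifts cover $\mathbb{R}^d$ with pairwise intersections of measure zero). *)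

(* Defs.v *)
From HB Require Import structures.
From mathcomp Require Import all_boot all_order all_algebra.
From mathcomp Require Import all_classical all_reals all_analysis.
From mathcomp Require Import complex.

Set Implicit Arguments.
Unset Strict Implicit.
Unset Printing Implicit Defensive.

Import Order.TTheory GRing.Theory Num.Theory.
Import numFieldNormedType.Exports.

Local Open Scope classical_set_scope.
Local Open Scope ring_scope.

Definition expanding (R : realType) (p : {poly int}) : Prop :=
  forall z : R[i], root (map_poly intr p) z -> 1 < `|z|.

(* Rows and columns are numbered from 0. *)
Definition companion (R : nzRingType) (d : nat) (p : seq R) : 'M[R]_d :=
  \matrix_(i < d, j < d)
    if j == d.-1 :> nat then - p`_i else (i == j.+1 :> nat)%:R.

Lemma companion_companionmx (R : nzRingType) (p : seq R) :
  companion (size p).-1 p = (companionmx p)^T.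
Proof.
by apply/matrixP => i j; rewrite !mxE (eq_sym (i : nat)).
Qed.

(* The k-th term of the series is M^-(k+1) a_k: digits are numbered from 0. *)
Definition attractor (R : realType) (d : nat) (M : 'M[R]_d)
    (D : set 'cV[R]_d) : set 'cV[R]_d :=
  [set v | exists2 a : nat -> 'cV[R]_d, (forall k, D (a k)) &
     series (fun k => invmx M ^+ k.+1 *m a k) @ \oo --> v].

Definition e1 (R : nzRingType) (d : nat) : 'cV[R]_d :=
  \col_(i < d) (i == 0 :> nat)%:R.

Section lebesgue_tuple.
Context (R : realType).
Local Notation RT := (measurableTypeR R).
Local Open Scope ereal_scope.

Definition cons_pair n (u : RT * n.-tuple RT) : n.+1.-tuple RT :=
  [tuple of u.1 :: u.2].

Section lebesgue_cons.
Variables (n : nat) (mu : {sigma_finite_measure set (n.-tuple RT) -> \bar R}).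

Definition lebesgue_cons : set (n.+1.-tuple RT) -> \bar R :=
  pushforward (lebesgue_measure \x mu) (@cons_pair n).

Let measurable_cons_pair : measurable_fun setT (@cons_pair n).
Proof. exact: measurable_cons. Qed.

Let lebesgue_cons0 : lebesgue_cons set0 = 0.
Proof. by rewrite /lebesgue_cons /pushforward preimage_set0 measure0. Qed.

Let lebesgue_cons_ge0 A : 0 <= lebesgue_cons A.
Proof. exact: measure_ge0. Qed.

Let lebesgue_cons_sigma_additive : semi_sigma_additive lebesgue_cons.
Proof.
move=> F mF tF mUF; rewrite /lebesgue_cons /pushforward preimage_bigcup.
apply: measure_semi_sigma_additive.
- by move=> k; rewrite -[X in measurable X]setTI; exact: measurable_cons_pair.
- apply/trivIsetP => /= i j _ _ ij; rewrite -preimage_setI.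
  by move/trivIsetP : tF => /(_ _ _ _ _ ij) ->//; rewrite preimage_set0.
- rewrite -preimage_bigcup -[X in measurable X]setTI.
  exact: measurable_cons_pair.
Qed.

HB.instance Definition _ := isMeasure.Build _ _ _ lebesgue_cons
  lebesgue_cons0 lebesgue_cons_ge0 lebesgue_cons_sigma_additive.

Let uncons (t : n.+1.-tuple RT) : RT * n.-tuple RT :=
  (tnth t ord0, [tuple of behead t]).

Let cons_pairK : cancel (@cons_pair n) uncons.
Proof. by case=> x t; congr pair; apply/val_inj. Qed.

Let measurable_uncons : measurable_fun setT uncons.
Proof.
by apply: measurable_fun_pair; [exact: measurable_tnth|exact: measurable_behead].
Qed.

Let lebesgue_cons_sigma_finite : sigma_finite setT lebesgue_cons.
Proof.
have /sigma_finiteP[F [TF ndF Foo]] := sigma_finiteT (@lebesgue_measure R).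
have /sigma_finiteP[G [TG ndG Goo]] := sigma_finiteT mu.
exists (fun k => uncons @^-1` (F k `*` G k)).
  rewrite -preimage_bigcup (_ : \bigcup_k _ = setT)//.
  apply/seteqP; split => // -[x y] _.
  have [k _ Fkx] : (\bigcup_k F k) x by rewrite -TF.
  have [l _ Gly] : (\bigcup_k G k) y by rewrite -TG.
  exists (maxn k l) => //; split => /=.
  - by move: x Fkx; exact/subsetPset/ndF/leq_maxl.
  - by move: y Gly; exact/subsetPset/ndG/leq_maxr.
move=> k; have [mF Fk] := Foo k; have [mG Gk] := Goo k; split.
  rewrite -[X in measurable X]setTI; apply: measurable_uncons => //.
  exact: measurableX.
rewrite /lebesgue_cons /pushforward -comp_preimage.
rewrite (_ : uncons \o _ = id); last by apply/funext => u; exact: cons_pairK.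
by rewrite preimage_id product_measure1E// lte_mul_pinfty// ge0_fin_numE.
Qed.

HB.instance Definition _ := Measure_isSigmaFinite.Build _ _ _ lebesgue_cons
  lebesgue_cons_sigma_finite.

End lebesgue_cons.

(* n-dimensional Lebesgue measure, as the n-fold product of the Lebesgue measure
   on the line. *)
Fixpoint lebesgue_tuple n : {sigma_finite_measure set (n.-tuple RT) -> \bar R} :=
  if n is k.+1 then lebesgue_cons (lebesgue_tuple k) else \d_[tuple].

Lemma lebesgue_tuple_box n (A : 'I_n -> set RT) :
  (forall i, measurable (A i)) ->
  lebesgue_tuple n [set t | forall i, A i (tnth t i)] =
  \prod_(i < n) lebesgue_measure (A i).
Proof.
elim: n A => [|n IH] A mA.
  by rewrite big_ord0 /= diracE mem_set//= => -[].
rewrite big_ord_recl -IH// -product_measure1E//=.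
  rewrite /lebesgue_cons /pushforward; congr (_ _).
  apply/seteqP; split => [[x t]/= h|[x t]/= [h0 h] i].
    split; first exact: h ord0.
    by move=> i; have := h (lift ord0 i); rewrite tnthS.
  case: (unliftP ord0 i) => [j ->|->//].
  by rewrite tnthS; exact: h.
rewrite (_ : mkset _ = \bigcap_(i in setT)
    ((@tnth n RT)^~ i @^-1` A (lift ord0 i))).
  apply: fin_bigcap_measurable => // i _.
  by rewrite -[X in measurable X]setTI; exact: measurable_tnth.
by apply/seteqP; split => [t h i _|t h i]; exact: h.
Qed.

End lebesgue_tuple.

Definition lebesgue_cV (R : realType) (d : nat) (A : set 'cV[R]_d) : \bar R :=
  lebesgue_tuple R d [set t | A (\col_i tnth t i)].

(* Attractors of expanding integer matrices are compact, hence measurable. *)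
Definition is_tile (R : realType) (d : nat) (G : set 'cV[R]_d) : Prop :=
  lebesgue_cV G = 1%E.

(* Main.v *)
Require Import Defs.
From HB Require Import structures.
From mathcomp Require Import all_boot all_order all_algebra.
From mathcomp Require Import all_classical all_reals all_analysis.
From mathcomp Require Import measurable_realfun complex.
From mathcomp Require Import zify ring lra.

(* Let T A be the preimage under M of the union of A and A + e, so that the
   attractor G satisfies T G = G, and call fundamental the sets whose integer
   translates partition R^d. The digits 0, e being a complete residue system
   modulo M Z^d, T preserves fundamental sets, and these all have measure 1.
   If B is bounded, contains the unit cube Q and T B is a subset of B, then G is
   the decreasing intersection of the T^m B, each of which contains the
   fundamental set T^m Q: hence the measure of G is at least 1.

   Conversely M multiplies volumes by 2, so that M G being the union of G and
   G + e forces G and G + e to overlap in a null set; and if G and G + k overlap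
   in a null set, so do G and G + (M k + s e) for s in {-1, 0, 1}. Hence G
   overlaps G + k in a null set whenever k is nonzero and of the form
   s_0 e + s_1 M e + ... + s_m M^m e with all s_i in {-1, 0, 1}. If this
   exhausts Z^d, the measure of G is at most 1.

   To see that every integer vector has such an expansion, one adds e or -e to
   an expansion digit by digit, with finitely many possible carries. For d = 2
   and d = 3 the signs of p at -1, 0, 1 and, for d = 3, the Schur-Cohn
   inequality |a_0 a_2 - a_1| < a_0^2 - 1 leave 20 polynomials, whose sets
   of carries are found and verified by computation. *)

Set Implicit Arguments.
Unset Strict Implicit.
Unset Printing Implicit Defensive.

Import Order.TTheory GRing.Theory Num.Theory.
Import numFieldNormedType.Exports.
Local Open Scope classical_set_scope.
Local Open Scope ring_scope.

(** * Lebesgue measure on column vectors *)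

(* The measurability of the map is an explicit argument of this canonical
   structure, so that it cannot be inferred. *)
Local Notation pushforward_measure :=
  measure_function_pushforward__canonical__measure_function_Measure.

Section translation.
Context (R : realType).
Local Notation RT := (measurableTypeR R).

Lemma lebesgue_measure_translation (a : R) (A : set RT) : measurable A ->
  lebesgue_measure ((fun x => x + a) @^-1` A) = lebesgue_measure A.
Proof.
move=> mA.
have mf : measurable_fun setT (fun x : RT => x + a : RT).
  by apply: measurable_funD.
rewrite (@lebesgue_measure_unique _
  (pushforward_measure lebesgue_measure mf) _ A)//.
move=> _ [[x y] _ <-]; rewrite /= /pushforward/=.
set P := (X in _ = _ X).
have -> : P = `]x - a, y - a]%classic.
  by apply/seteqP; split => z /=; rewrite !in_itv/= ltrBlDr lerBrDr.
rewrite !lebesgue_measure_itv/= !lte_fin ltrD2r; case: ifPn => // _.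
by rewrite -!EFinB opprB addrA subrK.
Qed.

Let add_tuple n (b : 'I_n -> R) (t : n.-tuple RT) : n.-tuple RT :=
  [tuple tnth t i + b i | i < n].

Let measurable_add_tuple n (b : 'I_n -> R) : measurable_fun setT (add_tuple b).
Proof.
apply/measurable_fun_tnthP => i.
rewrite (_ : _ \o _ = (fun t : n.-tuple RT => tnth t i + b i)).
  by apply: measurable_funD => //; exact: measurable_tnth.
by apply/funext => t /=; rewrite tnth_mktuple.
Qed.

(** A product measure is determined by its values on rectangles, where the two sides agree by
    induction on [n]. *)
Lemma lebesgue_tuple_translation n (b : 'I_n -> R) (A : set (n.-tuple RT)) :
  measurable A ->
  lebesgue_tuple R n [set t | A [tuple tnth t i + b i | i < n]] =
  lebesgue_tuple R n A.
Proof.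
elim: n b A => [|n IH] b A mA.
  congr (_ _); apply/seteqP.
  by split => t /=; rewrite (tuple0 (mktuple _)) (tuple0 t).
rewrite /= /lebesgue_cons /pushforward.
pose b' i := b (lift ord0 i).
pose g (u : RT * n.-tuple RT) : RT * n.-tuple RT :=
  (u.1 + b ord0, add_tuple b' u.2).
have mg : measurable_fun setT g.
  apply: measurable_fun_pair => /=; first exact: measurable_funD.
  exact: (measurableT_comp (measurable_add_tuple b') measurable_snd).
have mc : measurable (@cons_pair R n @^-1` A).
  rewrite -[X in measurable X]setTI.
  exact: (measurable_cons measurable_fst measurable_snd).
rewrite [RHS](@product_measure_unique _ _ _ _ _ _ _
  (pushforward_measure (lebesgue_measure \x lebesgue_tuple R n)%E mg))//.
  rewrite /= /pushforward; congr (_ _); apply/seteqP.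
  suff E u : [tuple tnth (cons_pair u) i + b i | i < n.+1] = cons_pair (g u).
    by split => u /=; rewrite E.
  apply: eq_from_tnth => i; rewrite tnth_mktuple.
  by case: (unliftP ord0 i) => [j ->|->//]; rewrite !tnthS tnth_mktuple.
move=> B C mB mC; rewrite /= /pushforward.
have mB' : measurable ((fun x : RT => x + b ord0 : RT) @^-1` B).
  by rewrite -[X in measurable X]setTI; apply: measurable_funD.
have mC' : measurable (add_tuple b' @^-1` C).
  by rewrite -[X in measurable X]setTI; apply: measurable_add_tuple.
rewrite (product_measure1E _ _ mB' mC').
by congr (_ * _)%E; [exact: lebesgue_measure_translation|exact: IH].
Qed.
End translation.

Section col_measure.
Context (R : realType) (n : nat).
Local Notation RT := (measurableTypeR R).

Let col_of (t : n.-tuple RT) : 'cV[R]_n := \col_i tnth t i.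

(** The sigma-algebra of tuples is carried over to columns, which makes [lebesgue_cV] a measure on a
    measurable type. *)
Definition col_measurable (A : set 'cV[R]_n) : Prop :=
  measurable [set t : n.-tuple RT | A (col_of t)].

Let col_measurable0 : col_measurable set0.
Proof. exact: measurable0. Qed.

Let col_measurableC A : col_measurable A -> col_measurable (~` A).
Proof. exact: measurableC. Qed.

Let col_measurable_bigcup (F : (set 'cV[R]_n)^nat) :
  (forall i, col_measurable (F i)) -> col_measurable (\bigcup_i F i).
Proof. by move=> mF; exact: bigcupT_measurable. Qed.

HB.instance Definition _ := @isMeasurable.Build
  default_measure_display 'cV[R]_n col_measurable
  col_measurable0 col_measurableC col_measurable_bigcup.

Let uncol (x : 'cV[R]_n) : n.-tuple RT := [tuple x i ord0 | i < n].

Let col_ofK : cancel col_of uncol.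
Proof. by move=> t; apply: eq_from_tnth => i; rewrite tnth_mktuple mxE. Qed.

Let uncolK : cancel uncol col_of.
Proof. by move=> x; apply/colP => i; rewrite mxE tnth_mktuple. Qed.

Lemma measurable_col_coord (i : 'I_n) :
  measurable_fun setT (fun x : 'cV[R]_n => x i ord0 : RT).
Proof.
move=> _ B mB; rewrite setTI.
change (measurable [set t : n.-tuple RT | B (col_of t i ord0)]).
rewrite (_ : mkset _ = (fun t : n.-tuple RT => tnth t i) @^-1` B).
  by rewrite -[X in measurable X]setTI; exact: measurable_tnth.
by apply/seteqP; split => t /=; rewrite mxE.
Qed.

Lemma measurable_fun_col d (T : measurableType d) (f : T -> 'cV[R]_n) :
  (forall i, measurable_fun setT (fun x => f x i ord0 : RT)) ->
  measurable_fun setT f.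
Proof.
move=> mf _ A mA; rewrite setTI.
have mg : measurable_fun setT (uncol \o f).
  apply/measurable_fun_tnthP => i.
  rewrite (_ : _ \o _ = (fun x => f x i ord0))//.
  by apply/funext => x /=; rewrite tnth_mktuple.
rewrite (_ : f @^-1` A = (uncol \o f) @^-1` [set t | A (col_of t)]).
  by rewrite -[X in measurable X]setTI; apply: mg.
by apply/seteqP; split => x /=; rewrite uncolK.
Qed.

Let measurable_col_of : measurable_fun setT col_of.
Proof. by move=> _ A mA; rewrite setTI. Qed.

Let lebesgue_cV0 : @lebesgue_cV R n set0 = 0%E.
Proof. exact: measure0. Qed.

Let lebesgue_cV_ge0 A : (0 <= @lebesgue_cV R n A)%E.
Proof. exact: measure_ge0. Qed.

Let lebesgue_cV_sigma_additive : semi_sigma_additive (@lebesgue_cV R n).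
Proof.
exact: (measure_semi_sigma_additive
  (s := pushforward_measure (lebesgue_tuple R n) measurable_col_of)).
Qed.

HB.instance Definition _ := isMeasure.Build _ _ _ (@lebesgue_cV R n)
  lebesgue_cV0 lebesgue_cV_ge0 lebesgue_cV_sigma_additive.

Let lebesgue_cV_sigma_finite : sigma_finite setT (@lebesgue_cV R n).
Proof.
have [F TF mF] := sigma_finiteT (lebesgue_tuple R n).
have E k : [set t | F k (uncol (col_of t))] = F k.
  by apply/seteqP; split => t /=; rewrite col_ofK.
exists (fun k => uncol @^-1` F k).
  by rewrite -preimage_bigcup -TF preimage_setT.
move=> k; have [mFk Fk] := mF k; split.
  by change (measurable [set t | F k (uncol (col_of t))]); rewrite E.
by rewrite /lebesgue_cV/= E.
Qed.

HB.instance Definition _ := Measure_isSigmaFinite.Build _ _ _ (@lebesgue_cV R n)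
  lebesgue_cV_sigma_finite.

Lemma lebesgue_cV_translation (b : 'cV[R]_n) (A : set 'cV[R]_n) :
  measurable A -> lebesgue_cV [set x | A (x + b)] = lebesgue_cV A.
Proof.
move=> mA; rewrite /lebesgue_cV.
rewrite -[RHS](lebesgue_tuple_translation (fun i => b i ord0))//.
suff E t : col_of t + b = col_of [tuple tnth t i + b i ord0 | i < n].
  by congr (_ _); apply/seteqP; split => t /=; rewrite -/(col_of _) E.
by apply/colP => i; rewrite !mxE tnth_mktuple.
Qed.

Definition unit_cube : set 'cV[R]_n := [set x | forall i, 0 <= x i ord0 < 1].

Lemma measurable_unit_cube : measurable unit_cube.
Proof.
rewrite (_ : unit_cube = \bigcap_(i in setT)
    ((fun x : 'cV[R]_n => x i ord0 : RT) @^-1` `[0, 1[%classic)).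
  apply: fin_bigcap_measurable => // i _.
  by rewrite -[X in measurable X]setTI; exact: measurable_col_coord.
apply/seteqP; split => x /= h i.
  by move=> _; rewrite /= in_itv; exact: h.
by have := h i I; rewrite /= in_itv.
Qed.

Lemma lebesgue_cV_unit_cube : lebesgue_cV unit_cube = 1%E.
Proof.
transitivity (\prod_(i < n) lebesgue_measure (`[0%R, 1%R[%classic : set RT))%E.
  rewrite -lebesgue_tuple_box// /lebesgue_cV; congr (_ _).
  by apply/seteqP; split => t /= h i; have := h i; rewrite /= ?mxE ?in_itv.
rewrite big1// => i _.
by rewrite lebesgue_measure_itv/= lte_fin ltr01 oppr0 adde0.
Qed.

Lemma measurable_fun_mulmx (m : nat) (P : 'M[R]_(m, n)) (i : 'I_m) :
  measurable_fun setT (fun x : 'cV[R]_n => (P *m x) i ord0 : RT).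
Proof.
rewrite (_ : (fun x => _) = fun x : 'cV[R]_n => \sum_j P i j * x j ord0).
  apply: measurable_sum => j; apply: measurable_funM => //.
  exact: measurable_col_coord.
by apply/funext => x; rewrite mxE.
Qed.

End col_measure.

(** * Linear changes of variables *)

Section scaling.
Context (R : realType) (n : nat).
Local Notation V := 'cV[R]_n.
Local Notation mu := (@lebesgue_cV R n).
Local Open Scope ereal_scope.

(** Tonelli's theorem for the indicator function of [H]. *)
Lemma integral_section_swap (H : set (V * V)) : measurable H ->
  \int[mu]_x mu [set y | H (x, y)] = \int[mu]_y mu [set x | H (x, y)].
Proof.
move=> mH.
have := @indic_fubini_tonelli _ _ _ _ R mu mu H mH.
rewrite (indic_fubini_tonelli_FE _ mH) (indic_fubini_tonelli_GE _ mH).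
under eq_integral do rewrite /= xsectionE.
by under [in X in _ = X -> _]eq_integral do rewrite /= ysectionE.
Qed.

(* Q being the unit cube, the integral of 1_A(P x + y) 1_Q(y) over all (x, y)
   is computed by translating x by P^-1 y, or else y by - P x. *)
Lemma lebesgue_cV_unitmx (P : 'M[R]_n) (A : set V) : P \in unitmx ->
  measurable A ->
  mu [set x | A (P *m x)%R] = mu A * mu [set x | unit_cube (- (P *m x))%R].
Proof.
move=> Pu mA; set Q := @unit_cube R n.
have mQ : measurable Q by exact: measurable_unit_cube.
have mP : measurable_fun setT (fun x : V => (P *m x)%R).
  by apply: measurable_fun_col => i; exact: measurable_fun_mulmx.
have coord i := @measurable_col_coord R n i.
pose f (u : V * V) : V := (P *m u.1 + u.2)%R.
have mf : measurable_fun setT f.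
  apply: measurable_fun_col => i; rewrite (_ : (fun u => _) =
    (fun u : V * V => (P *m u.1) i ord0)%R \+ (fun u : V * V => u.2 i ord0))%R.
    apply: measurable_funD.
      exact: (measurableT_comp (measurable_fun_mulmx P i) measurable_fst).
    exact: (measurableT_comp (coord i) measurable_snd).
  by apply/funext => u; rewrite mxE.
pose g (u : V * V) : V := (u.2 - P *m u.1)%R.
have mg : measurable_fun setT g.
  apply: measurable_fun_col => i; rewrite (_ : (fun u => _) =
    (fun u : V * V => u.2 i ord0) \- (fun u : V * V => (P *m u.1) i ord0)%R)%R.
    apply: measurable_funB.
      exact: (measurableT_comp (coord i) measurable_snd).
    exact: (measurableT_comp (measurable_fun_mulmx P i) measurable_fst).
  by apply/funext => u; rewrite /g /= !mxE.
have mpre d (T : measurableType d) (h : T -> V) B : measurable B ->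
    measurable_fun setT h -> measurable [set x | B (h x)].
  by move=> mB mh; rewrite -[X in measurable X]setTI; exact: mh.
have m2 : measurable_fun setT (@snd V V) by exact: measurable_snd.
have intE B k (h : V -> \bar R) : measurable B ->
    (forall y, h y = if y \in B then k else 0) -> \int[mu]_y h y = k * mu B.
  move=> mB hE; rewrite -integral_cst// [RHS]integral_mkcond.
  by apply: eq_integral => y _; rewrite hE patchE.
have mH : measurable ([set u | A (f u)] `&` [set u | Q u.2]).
  by apply: measurableI; exact: mpre.
have := integral_section_swap mH.
rewrite [X in _ = X -> _](intE Q (mu [set x | A (P *m x)%R])) //; last first.
  move=> y; case: ifPn => [/set_mem Qy|/negP yQ].
    rewrite -[RHS](@lebesgue_cV_translation _ _ (invmx P *m y)%R).
      by congr (_ _); apply/seteqP; split => x /=;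
        rewrite mulmxDr mulmxA mulmxV// mul1mx//; case.
    exact: mpre.
  rewrite (_ : mkset _ = set0) ?measure0//.
  by apply/seteqP; split => // x /= -[_ Qy]; apply: yQ; rewrite inE.
rewrite lebesgue_cV_unit_cube mule1 => <-.
transitivity (\int[mu]_x mu [set y |
    ([set u | A u.2] `&` [set u | Q (g u)]) (x, y)]).
  apply: eq_integral => x _.
  rewrite -[RHS](@lebesgue_cV_translation _ _ (P *m x)%R).
    congr (_ _); apply/seteqP; split => y /= -[];
    by rewrite /f /g /= addrK (addrC y).
  apply: measurableI => //; apply: mpre => //.
  exact: (measurable_fun_pair2 x mg).
rewrite integral_section_swap; last by apply: measurableI; exact: mpre.
rewrite (intE A (mu [set x | Q (- (P *m x))%R])) 1?muleC// => y.
case: ifPn => [/set_mem Ay|/negP yA].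
  rewrite -[RHS](@lebesgue_cV_translation _ _ (- (invmx P *m y))%R).
    congr (_ _); apply/seteqP; split => x /=;
    by rewrite /g /= mulmxDr mulmxN mulmxA mulmxV// mul1mx opprB //; case.
  apply: mpre => //; rewrite (_ : (fun x => _) = fun x => g (x, 0)%R).
    exact: (@measurable_fun_pair1 _ _ _ V V V g 0%R mg).
  by apply/funext => x; rewrite /g sub0r.
rewrite (_ : mkset _ = set0) ?measure0//.
by apply/seteqP; split => // x /= -[Ay _]; apply: yA; rewrite inE.
Qed.
End scaling.

(** * Fundamental domains and overlaps *)

Section lattice.
Context (R : realType) (n : nat).
Local Notation V := 'cV[R]_n.
Local Notation mu := (@lebesgue_cV R n).
Implicit Types (A F : set V) (k : 'cV[int]_n).

Definition ivec k : V := map_mx intr k.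

Lemma ivec0 : ivec 0 = 0. Proof. exact: map_mx0. Qed.
Lemma ivecD k l : ivec (k + l) = ivec k + ivec l. Proof. exact: map_mxD. Qed.
Lemma ivecN k : ivec (- k) = - ivec k. Proof. exact: map_mxN. Qed.

Definition fundamental F :=
  (forall x, exists k, F (x - ivec k)) /\
  (forall x k, F x -> F (x - ivec k) -> k = 0).

Lemma measurable_shift A (b : V) :
  measurable A -> measurable [set x | A (x + b)].
Proof.
move=> mA; rewrite -[X in measurable X]setTI.
suff mf : measurable_fun setT (fun x : V => x + b) by exact: mf.
apply: measurable_fun_col => i.
rewrite (_ : (fun x => _) = (fun x : V => x i ord0) \+ cst (b i ord0)).
  by apply: measurable_funD => //; exact: measurable_col_coord.
by apply/funext => x; rewrite mxE.
Qed.

(* Once the null overlaps are removed from A, it is cut along the translates of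
   F and the pieces are moved into F, where they remain disjoint. *)
Lemma le_lebesgue_fundamental A F : measurable A -> measurable F ->
  (forall k, k != 0 -> mu (A `&` [set x | A (x - ivec k)]) = 0%E) ->
  fundamental F -> (mu A <= mu F)%E.
Proof.
move=> mA mF A0 [Fcover Fpack].
(* Integer vectors are enumerated through [pickle_inv], so that unions over them are countable
   unions over [nat]; an index that codes no vector contributes the empty set. *)
pose S i := if pickle_inv i is Some k then
    if k == 0 :> 'cV[int]_n then set0 else A `&` [set x | A (x - ivec k)]
  else set0.
have mS i : measurable (S i).
  rewrite /S; case: pickle_inv => [k|]; last exact: measurable0.
  case: ifP => _; first exact: measurable0.
  by apply: measurableI => //; exact: measurable_shift.
have mUS : measurable (\bigcup_i S i) by exact: bigcupT_measurable.
have US0 : mu (\bigcup_i S i) = 0%E.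
  apply/negligibleP => //; apply: negligible_bigcup => i.
  apply/negligibleP => //; rewrite /S.
  case: pickle_inv => [k|]; last exact: measure0.
  by case: ifPn => [_|k0]; [exact: measure0|exact: A0].
pose A' := A `\` \bigcup_i S i.
have mA' : measurable A' by exact: measurableD.
have A'pack x k l : A' (x + ivec k) -> A' (x + ivec l) -> k = l.
  move=> [Ak nSk] [Al _]; apply: contrapT => /eqP kl; apply: nSk.
  exists (pickle (k - l)) => //; rewrite /S pickleK_inv subr_eq0 (negbTE kl).
  by split => //=; rewrite ivecD ivecN opprB -addrA [ivec k + _]addrC subrK.
have -> : mu A = mu A'.
  rewrite [LHS](measureDI _ mA mUS) [X in (_ + X)%E](_ : _ = 0%E) ?adde0//.
  apply: (subset_measure0 _ mUS (@subIsetr _ _ _) US0).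
  exact: measurableI.
pose P i := if pickle_inv i is Some k then
  A' `&` [set x | F (x - ivec k)] else set0.
pose Q i := if pickle_inv i is Some k then
  [set x | A' (x + ivec k)] `&` F else set0.
have mP i : measurable (P i).
  rewrite /P; case: pickle_inv => [k|]; last exact: measurable0.
  by apply: measurableI => //; exact: measurable_shift.
have mQ i : measurable (Q i).
  rewrite /Q; case: pickle_inv => [k|]; last exact: measurable0.
  by apply: measurableI => //; exact: measurable_shift.
have PQ i : mu (P i) = mu (Q i).
  rewrite /P /Q; case: pickle_inv => [k|//].
  rewrite -(@lebesgue_cV_translation _ _ (ivec k)); last first.
    by apply: measurableI => //; exact: measurable_shift.
  by congr (_ _); apply/seteqP; split => x /=; rewrite addrK.
have pinv i k : @pickle_inv 'cV[int]_n i = Some k -> i = pickle k.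
  by have := @pickle_invK 'cV[int]_n i => /[swap] ->.
have A'P : A' = \bigcup_i P i.
  apply/seteqP; split => [x A'x|x [i _]].
    have [k Fk] := Fcover x; exists (pickle k) => //.
    by rewrite /P pickleK_inv.
  by rewrite /P; case: pickle_inv => // k [].
have tP : trivIset setT P.
  apply/trivIsetP => i j _ _ ij; apply/seteqP; split => // x [].
  rewrite /P; case Ei: pickle_inv => [k|//]; case Ej: pickle_inv => [l|//].
  move=> [_ Fk] [_ Fl]; move/eqP : ij; apply.
  rewrite (pinv _ _ Ei) (pinv _ _ Ej); congr pickle; apply/eqP.
  rewrite eq_sym -subr_eq0; apply/eqP/(Fpack _ _ Fk).
  by rewrite ivecD ivecN opprB addrA subrK.
have tQ : trivIset setT Q.
  apply/trivIsetP => i j _ _ ij; apply/seteqP; split => // x [].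
  rewrite /Q; case Ei: pickle_inv => [k|//]; case Ej: pickle_inv => [l|//].
  move=> [A'k _] [A'l _]; move/eqP : ij; apply.
  by rewrite (pinv _ _ Ei) (pinv _ _ Ej) (A'pack _ _ _ A'k A'l).
rewrite A'P measure_semi_bigcup//; last by rewrite -A'P.
rewrite (eq_eseriesr (fun i _ => PQ i)).
have mUQ : measurable (\bigcup_i Q i) by exact: bigcupT_measurable.
rewrite -measure_semi_bigcup//.
apply: le_measure; rewrite ?inE// => x [i _].
by rewrite /Q; case: pickle_inv => // k [].
Qed.

Lemma lebesgue_fundamental F1 F2 : measurable F1 -> measurable F2 ->
  fundamental F1 -> fundamental F2 -> mu F1 = mu F2.
Proof.
suff le F F' : measurable F -> measurable F' -> fundamental F ->
    fundamental F' -> (mu F <= mu F')%E.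
  by move=> m1 m2 f1 f2; apply/eqP; rewrite eq_le !le.
move=> mF mF' fF fF'; apply: le_lebesgue_fundamental => // k k0.
rewrite (_ : _ `&` _ = set0) ?measure0//; apply/seteqP; split => // x [Fx Fxk].
by move: k0; rewrite (fF.2 x k)// eqxx.
Qed.

Lemma fundamental_unit_cube : fundamental (@unit_cube R n).
Proof.
split => [x|x k Qx Qxk].
  exists (\col_i Num.floor (x i ord0)) => i; rewrite !mxE.
  by have := floor_itv (x i ord0); rewrite intrD subr_ge0 ltrBlDl addrC.
apply/colP => i; rewrite !mxE.
have /andP[x0 x1] := Qx i; have := Qxk i; rewrite !mxE => /andP[xk0 xk1].
have k1 : k i ord0 < 1 by rewrite -(ltr_int R); lra.
have : -1 < k i ord0 by rewrite -(ltr_int R); lra.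
by change (-1 < k i ord0 -> k i ord0 = 0); move: (k i ord0) k1 => m; lia.
Qed.

End lattice.

(** Horner form: each step shifts the expansion by [N] and appends a new lowest digit, which suits
    both the induction on overlaps and the addition with carries. *)
Inductive ternary n (N : 'M[int]_n) (e : 'cV[int]_n) : 'cV[int]_n -> Prop :=
| ternary0 : ternary N e 0
| ternaryS k (s : int) : ternary N e k -> `|s| <= 1 ->
    ternary N e (N *m k + s *: e).

(** * Measure of self-affine sets *)

Section self_affine.
Context (R : realType) (n : nat) (N : 'M[int]_n) (e : 'cV[int]_n).
Local Notation V := 'cV[R]_n.
Local Notation mu := (@lebesgue_cV R n).
Local Notation M := (map_mx intr N : 'M[R]_n).
Local Notation ivec := (@ivec R n).
Hypothesis M_unit : M \in unitmx.
Hypothesis digits_cover : forall m, exists k, m = N *m k \/ m = N *m k + e.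
Hypothesis e_odd : forall k, N *m k <> e.
Implicit Types (A F : set V) (k : 'cV[int]_n).

Definition hutchinson A : set V :=
  [set x | A (M *m x) \/ A (M *m x - ivec e)].

Let ivecM k : ivec (N *m k) = M *m ivec k.
Proof. exact: map_mxM. Qed.

Let N_inj (k : 'cV[int]_n) : N *m k = 0 -> k = 0.
Proof.
move=> Nk0; have : M *m ivec k = 0 by rewrite -ivecM Nk0 ivec0.
move=> /(congr1 (mulmx (invmx M))); rewrite mulmxA mulVmx// mul1mx mulmx0.
move=> /colP k0; apply/colP => i; have := k0 i; rewrite !mxE => /eqP.
by rewrite intr_eq0 => /eqP.
Qed.

Lemma measurable_mulmx A : measurable A -> measurable [set x | A (M *m x)].
Proof.
move=> mA; rewrite -[X in measurable X]setTI.
suff mf : measurable_fun setT (fun x : V => M *m x) by exact: mf.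
by apply: measurable_fun_col => i; exact: measurable_fun_mulmx.
Qed.

Lemma measurable_hutchinson A : measurable A -> measurable (hutchinson A).
Proof.
move=> mA; apply: (@measurable_mulmx (A `|` [set x | A (x - ivec e)])).
by apply: measurableU => //; exact: measurable_shift.
Qed.

(** The residue modulo [N] of the vector that moves [M x] into [F] tells which half of
    [hutchinson F] is reached. Equivalent points in different halves would make [N *m k] equal to
    [e] or to [- e], against [e_odd]. *)
Lemma fundamental_hutchinson F : fundamental F -> fundamental (hutchinson F).
Proof.
move=> [Fcover Fpack]; split => [x|x k].
  have [m Fm] := Fcover (M *m x); have [k [mE|mE]] := digits_cover m; exists k.
    by left; rewrite mulmxBr -ivecM -mE.
  by right; rewrite mulmxBr -ivecM -addrA -opprD -ivecD -mE.
rewrite /hutchinson /= mulmxBr -ivecM => -[Fx [Fxk|Fxk]|Fx [Fxk|Fxk]].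
- exact/N_inj/(Fpack _ _ Fx).
- rewrite -addrA -opprD -ivecD in Fxk; have /eqP := Fpack _ _ Fx Fxk.
  by rewrite addr_eq0 eq_sym eqr_oppLR -mulmxN eq_sym => /eqP/e_odd.
- have : N *m k - e = 0.
    by apply: (Fpack _ _ Fx); rewrite ivecD ivecN opprB addrA subrK.
  by move/eqP; rewrite subr_eq0 => /eqP/e_odd.
- by apply/N_inj/(Fpack _ _ Fx); rewrite addrAC.
Qed.

Lemma lebesgue_fundamental1 F : measurable F -> fundamental F -> mu F = 1%E.
Proof.
move=> mF fF; rewrite -(lebesgue_cV_unit_cube R n).
apply: lebesgue_fundamental => //.
  exact: measurable_unit_cube.
exact: fundamental_unit_cube.
Qed.

(** No determinant is computed: the unit cube and its translate by [e] form a set of measure 2,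
    whose preimage under [M] is fundamental, hence of measure 1. *)
Lemma lebesgue_cV_scaling A : measurable A ->
  (mu [set x | A (M *m x)] * 2%:E)%E = mu A.
Proof.
move=> mA; have mQ := @measurable_unit_cube R n.
have fQ := @fundamental_unit_cube R n.
pose Q := @unit_cube R n.
have Q2 : mu (Q `|` [set x | Q (x - ivec e)]) = 2%:E.
  rewrite measureU//=.
  - by rewrite lebesgue_cV_translation// lebesgue_cV_unit_cube -EFinD.
  - exact: measurable_shift.
  - apply/seteqP; split => // x [Qx Qxe].
    by have := @e_odd 0; rewrite mulmx0 (fQ.2 _ _ Qx Qxe).
have mQ2 : measurable (Q `|` [set x | Q (x - ivec e)]).
  by apply: measurableU => //; exact: measurable_shift.
have := lebesgue_cV_unitmx M_unit mQ2.
rewrite Q2 (_ : mu _ = 1%E) => [c1|]; last first.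
  apply: (@lebesgue_fundamental1 (hutchinson Q)).
    exact: measurable_hutchinson.
  exact: fundamental_hutchinson.
by rewrite lebesgue_cV_unitmx// -muleA [X in (_ * X)%E]muleC -c1 mule1.
Qed.

Section upper_bound.
Variable G : set V.
Hypotheses (mG : measurable G) (Gfin : (mu G < +oo)%E).
Hypothesis GE : hutchinson G = G.

Let overlap_e : mu (G `&` [set x | G (x - ivec e)]) = 0%E.
Proof.
set G' := [set x | G (x - ivec e)].
have mG' : measurable G' by exact: measurable_shift.
have G'E : mu G' = mu G by exact: lebesgue_cV_translation.
have := lebesgue_cV_scaling (measurableU _ _ mG mG').
have -> : mu (G `|` G') = (mu G + mu G - mu (G `&` G'))%E.
  by rewrite -[X in (_ + X - _)%E]G'E; exact: measureUfinl.
rewrite [X in (mu X * _)%E](_ : _ = hutchinson G)// GE.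
have Gf : mu G \is a fin_num by rewrite ge0_fin_numE.
have If : mu (G `&` G') \is a fin_num.
  by rewrite ge0_fin_numE// (le_lt_trans _ Gfin)//; apply: measureIl.
by rewrite -(fineK Gf) -(fineK If) -EFinM -!EFinD => -[E]; congr EFin; lra.
Qed.

Lemma null_overlap k : ternary N e k -> k != 0 ->
  mu (G `&` [set x | G (x - ivec k)]) = 0%E.
Proof.
elim=> [|{}k s _ IH s1 Nks0]; first by rewrite eqxx.
have mGk l : measurable [set x | G (x - ivec l)] by exact: measurable_shift.
(* Each of -1, 0, 1 is a difference of digits: [s *: e] is written [d' - d] with [d] and [d'] in
   [{0, e}]. *)
have key (d d' : 'cV[int]_n) : d = 0 \/ d = e -> d' = 0 \/ d' = e ->
    N *m k + d' - d != 0 ->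
    mu (G `&` [set x | G (x - ivec (N *m k + d' - d))]) = 0%E.
  move=> d0e d'0e kdd'.
  rewrite (_ : _ `&` _ = [set x | ([set y | G (y - ivec d)] `&`
     [set y | G (y - ivec (N *m k + d'))]) (x + ivec d)]); last first.
    apply/seteqP; split => x /=; rewrite addrK;
    by rewrite [ivec (_ - d)]ivecD ivecN opprB addrA.
  rewrite lebesgue_cV_translation; last exact: measurableI.
  (* The induction hypothesis says nothing of [k = 0]; there [d] and [d'] differ and, after the
     translation by [d], the overlap is that of [G] and [G + e]. *)
  have [k0|k0] := eqVneq k 0.
    move: kdd'; rewrite k0 mulmx0 add0r.
    case: d0e => ->; case: d'0e => ->; rewrite ?subrr ?eqxx// => _.
      rewrite (_ : mkset _ = G)//.
      by apply/seteqP; split => x /=; rewrite ivec0 subr0.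
    rewrite setIC [X in X `&` _](_ : mkset _ = G)//.
    by apply/seteqP; split => x /=; rewrite ivec0 subr0.
  (* Since [hutchinson G = G], this is the image under [M] of the overlap of [G] and [G + k]. *)
  pose A := (G `|` [set x | G (x - ivec e)]) `&`
    ([set x | G (x - ivec (N *m k))] `|` [set x | G (x - ivec (N *m k + e))]).
  have mA : measurable A by apply: measurableI; apply: measurableU.
  have A0 : mu A = 0%E.
    rewrite -lebesgue_cV_scaling//.
    rewrite [X in mu X](_ : _ = G `&` [set x | G (x - ivec k)]).
      by rewrite (IH k0) mul0e.
    rewrite -[in RHS]GE; apply/seteqP; split => x /=;
    by rewrite /A /hutchinson /= mulmxBr -ivecM ivecD opprD addrA.
  apply: subset_measure0 A0 => //; first exact: measurableI.
  move=> x [Gd Gd']; split.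
    by case: d0e Gd => -> /=; rewrite ?ivec0 ?subr0; [left|right].
  by case: d'0e Gd' => -> /=; rewrite ?addr0; [left|right].
have : [\/ s = 0, s = 1 | s = -1].
  case: s s1 {Nks0} => [[|[|?]]|[|?]]// _;
  by [apply: Or31|apply: Or32|apply: Or33].
case=> sE; move: Nks0; rewrite sE ?scale0r ?scale1r ?scaleN1r.
- by move=> ?; have := key 0 0; rewrite subr0; apply; [left|left|].
- by move=> ?; have := key 0 e; rewrite subr0; apply; [left|right|].
- by move=> ?; have := key e 0; rewrite addr0; apply; [right|left|].
Qed.

Lemma lebesgue_self_affine_le1 : (forall k, ternary N e k) -> (mu G <= 1)%E.
Proof.
move=> tern; rewrite -(lebesgue_cV_unit_cube R n).
apply: le_lebesgue_fundamental => //.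
- exact: measurable_unit_cube.
- by move=> k k0; exact: null_overlap.
- exact: fundamental_unit_cube.
Qed.

End upper_bound.

Lemma lebesgue_self_affine_ge1 (B : set V) : measurable B -> (mu B < +oo)%E ->
  hutchinson B `<=` B -> @unit_cube R n `<=` B ->
  (1 <= mu (\bigcap_m iter m hutchinson B))%E.
Proof.
move=> mB Bfin BB QB.
have mono A A' : A `<=` A' -> hutchinson A `<=` hutchinson A'.
  by move=> AA' x [/AA' ?|/AA' ?]; [left|right].
have mT m A : measurable A -> measurable (iter m hutchinson A).
  by move=> mA; elim: m => //= m; exact: measurable_hutchinson.
have fT m : fundamental (iter m hutchinson (@unit_cube R n)).
  elim: m => [|m]; [exact: fundamental_unit_cube|exact: fundamental_hutchinson].
have QT m : iter m hutchinson (@unit_cube R n) `<=` iter m hutchinson B.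
  by elim: m => //= m; exact: mono.
have mcap : measurable (\bigcap_m iter m hutchinson B).
  by apply: bigcapT_measurable => m; exact: mT.
have decr : nonincreasing_seq (fun m => iter m hutchinson B).
  apply/nonincreasing_seqP => m; apply/subsetPset.
  by elim: m => // m; exact: mono.
have cvg := nonincreasing_cvg_mu (mu := mu) Bfin (fun m => mT m _ mB) mcap decr.
apply: (cvge_to_ge cvg); apply: nearW => m /=.
have mTQ := mT m _ (@measurable_unit_cube R n).
rewrite -(lebesgue_fundamental1 mTQ (fT m)).
by apply: le_measure; rewrite ?inE//; exact: mT.
Qed.

End self_affine.

(** * The attractor as a decreasing intersection *)

Section col_convergence.
Context (R : realType) (n : nat).

Lemma cvg_colP (u : nat -> 'cV[R]_n) (v : 'cV[R]_n) :
  u @ \oo --> v <-> forall i, (fun m => u m i ord0) @ \oo --> v i ord0.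
Proof.
split => [uv i|uv].
  exact: (cvg_comp _ _ uv (@coord_continuous R n 1 i ord0 v)).
apply/cvgrPdist_le => eps eps0.
have {}uv i : \forall m \near \oo, `|v i ord0 - u m i ord0| <= eps.
  by have /cvgrPdist_le := uv i; exact.
apply: filterS (filter_forall _ uv) => m um.
rewrite [leLHS]/Num.norm /= mx_normrE.
apply/bigmax_leP; split => [|[i j] _ /=]; first exact: ltW.
by rewrite !mxE (ord1 j).
Qed.

Lemma cvg_mulmx m (P : 'M[R]_(m, n)) (u : nat -> 'cV[R]_n) (v : 'cV[R]_n) i :
  u @ \oo --> v -> (fun k => (P *m u k) i ord0) @ \oo --> (P *m v) i ord0.
Proof.
move=> /cvg_colP uv; rewrite mxE.
rewrite (_ : (fun k => _) = fun k => \sum_j P i j * u k j ord0); last first.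
  by apply/funext => k; rewrite mxE.
apply: (@cvg_big R 'I_n +%R 0 xpredT (@add_continuous R) _ _ _
  (fun j k => P i j * u k j ord0) (fun j => P i j * v j ord0)) => j _.
exact: cvgMl_tmp (uv j).
Qed.

End col_convergence.

Section attractor.
Context (R : realType) (n : nat) (N : 'M[int]_n) (e : 'cV[int]_n).
Local Notation V := 'cV[R]_n.
Local Notation mu := (@lebesgue_cV R n).
Local Notation M := (map_mx intr N : 'M[R]_n).
Local Notation W := (invmx M).
Local Notation ivec := (@ivec R n).
Local Notation T := (@hutchinson R n N e).
Local Notation G := (attractor M [set 0; ivec e]).
Hypothesis M_unit : M \in unitmx.
Variables (C rho : R).
Hypothesis rho01 : 0 < rho < 1.
Hypothesis W_decay : forall k i j, `|(W ^+ k) i j| <= C * rho ^+ k.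

Let W_bound k (x : V) b i : (forall j, `|x j ord0| <= b) ->
  `|(W ^+ k *m x) i ord0| <= n%:R * C * b * rho ^+ k.
Proof.
move=> xb; rewrite mxE (le_trans (ler_norm_sum _ _ _))//.
have -> : n%:R * C * b * rho ^+ k = \sum_(j < n) C * rho ^+ k * b.
  by rewrite sumr_const card_ord -mulr_natl; ring.
by apply: ler_sum => j _; rewrite normrM ler_pM.
Qed.

(* A ball of the adapted norm x |-> sup_k rho^-k |W^k x|, for which W is a
   contraction. *)
Definition absorbing (c : R) : set V :=
  [set x | forall k i, `|(W ^+ k *m x) i ord0| <= c * rho ^+ k].

Let WM (x : V) : W *m (M *m x) = x.
Proof. by rewrite mulmxA mulVmx// mul1mx. Qed.

Let MW (x : V) : M *m (W *m x) = x.
Proof. by rewrite mulmxA mulmxV// mul1mx. Qed.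

Let WS k (x : V) : W ^+ k.+1 *m x = W ^+ k *m (W *m x).
Proof. by rewrite exprSr -mulmxE mulmxA. Qed.

Lemma measurable_absorbing c : measurable (absorbing c).
Proof.
rewrite (_ : absorbing c = \bigcap_k \bigcap_(i in setT)
  ((fun x : V => (W ^+ k *m x) i ord0) @^-1`
    `[- (c * rho ^+ k), c * rho ^+ k]%classic)).
  apply: bigcapT_measurable => k; apply: fin_bigcap_measurable => // i _.
  rewrite -[X in measurable X]setTI.
  by apply: measurable_fun_mulmx => //; exact: measurable_itv.
apply/seteqP; split => x /= h k.
  by move=> _ i _; rewrite /= in_itv/= -ler_norml.
by move=> i; have := h k I i I; rewrite /= in_itv/= -ler_norml.
Qed.

Lemma lebesgue_absorbing c : (mu (absorbing c) < +oo)%E.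
Proof.
pose box : set V := [set x | forall i, x i ord0 \in `[- c, c]].
have mbox : measurable box.
  rewrite (_ : box = \bigcap_(i in setT)
      ((fun x : V => x i ord0) @^-1` `[- c, c]%classic)).
    apply: fin_bigcap_measurable => // i _; rewrite -[X in measurable X]setTI.
    by apply: measurable_col_coord => //; exact: measurable_itv.
  by apply/seteqP; split => x /= h i; [move=> _; exact: h|exact: h].
apply: (@le_lt_trans _ _ (mu box)).
  apply: le_measure; rewrite ?inE//; first exact: measurable_absorbing.
  move=> x xc i; have := xc 0%N i.
  by rewrite expr0 expr0 mulr1 mul1mx in_itv/= -ler_norml.
pose J : set (measurableTypeR R) := `[- c, c]%classic.
rewrite (_ : mu box = \prod_(i < n) lebesgue_measure J)%E.
  suff : (\prod_(i < n) lebesgue_measure J)%E \is a fin_num.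
    by rewrite fin_numElt => /andP[].
  elim/big_ind: _ => // [x y|i _]; first exact: fin_numM.
  by rewrite lebesgue_measure_itv/= lte_fin; case: ifP.
rewrite -lebesgue_tuple_box; last by move=> _; exact: measurable_itv.
rewrite /lebesgue_cV; congr (_ _).
by apply/seteqP; split => t /= h i; have := h i; rewrite /J /= ?mxE.
Qed.

Section constant.
Variable c : R.
Hypothesis c_cube : n%:R * C <= c.
Hypothesis c_digit : rho * (c + n%:R * C * \sum_j `|(e j ord0)%:~R|) <= c.
Local Notation B := (absorbing c).

Lemma unit_cube_absorbing : @unit_cube R n `<=` B.
Proof.
move=> x Qx k i.
have := @W_bound k x 1 i; rewrite mulr1 => /(_ _)/le_trans; apply.
  by move=> j; have /andP[x0 x1] := Qx j; rewrite ger0_norm// ltW.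
by rewrite ler_wpM2r// exprn_ge0// ltW//; case/andP: rho01.
Qed.

(** As [y = W (M y - d) + W d], the adapted norm of [y] is at most [rho] times the sum of [c] and a
    bound on the norm of the digit [d]; [c_digit] brings this below [c]. *)
Lemma hutchinson_absorbing : T B `<=` B.
Proof.
have /andP[rho0 _] := rho01.
suff WB d y : d = 0 \/ d = ivec e -> B (M *m y - d) -> B y.
  move=> y [|]; last by apply: WB; right.
  by rewrite -[X in B X]subr0; apply: WB; left.
move=> dE By k i.
rewrite -[y]WM -(subrK d (M *m y)) mulmxDr mulmxDr -2!WS [X in `|X|]mxE.
rewrite (le_trans (ler_normD _ _))//.
have dk : `|(W ^+ k.+1 *m d) i ord0| <=
    n%:R * C * (\sum_j `|(e j ord0)%:~R|) * rho ^+ k.+1.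
  apply: W_bound => j; case: dE => ->; rewrite mxE ?normr0 ?sumr_ge0//.
  by rewrite (bigD1 j)//= lerDl sumr_ge0.
rewrite (le_trans (lerD (By k.+1 i) dk))// -mulrDl exprS mulrA.
rewrite ler_wpM2r//; first by rewrite exprn_ge0// ltW.
by rewrite [leLHS]mulrC.
Qed.

Let iter_sub m : iter m.+1 T B `<=` iter m T B.
Proof.
elim: m => [|m IH]; first exact: hutchinson_absorbing.
by move=> x [/IH|/IH]; [left|right].
Qed.

Let iter_le m k : (m <= k)%N -> iter k T B `<=` iter m T B.
Proof.
move=> /subnK <-; elim: (k - m)%N => [//|l IH] x.
by rewrite addSn => /iter_sub/IH.
Qed.

Let absorbing0 : B 0.
Proof.
have /andP[rho0 _] := rho01.
move=> k i; rewrite mulmx0 mxE normr0 mulr_ge0//; last first.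
  by rewrite exprn_ge0// ltW.
apply: le_trans c_cube; rewrite mulr_ge0//.
have := W_decay 0 i i; rewrite !expr0 mulr1.
exact: (le_trans (normr_ge0 _)).
Qed.

Let series_absorbing (a : nat -> V) m : (forall k, [set 0; ivec e] (a k)) ->
  B (series (fun k => W ^+ k.+1 *m a k) m).
Proof.
elim: m a => [|m IH] a ae.
  by rewrite /series /= big_geq//; exact: absorbing0.
have -> : series (fun k => W ^+ k.+1 *m a k) m.+1 =
    W *m (a 0%N + series (fun k => W ^+ k.+1 *m a k.+1) m).
  rewrite /series /= big_nat_recl// expr1 mulmxDr; congr (_ + _).
  rewrite mulmx_sumr; apply: eq_bigr => k _.
  by rewrite exprS -mulmxE mulmxA.
have BS := IH (fun k => a k.+1) (fun k => ae k.+1).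
apply: hutchinson_absorbing; rewrite /hutchinson /= MW.
by case: (ae 0%N) => -> ; [left; rewrite add0r|right; rewrite addrC addKr].
Qed.

Let attractor_absorbing : G `<=` B.
Proof.
move=> x [a ae ax] k i.
apply: (cvgr_to_le (cvg_norm (@cvg_mulmx _ _ _ (W ^+ k) _ _ i ax))).
by apply: nearW => m; exact: series_absorbing.
Qed.

(** Dropping the first digit [a 0] of [x] leaves an expansion of [M x - a 0]. *)
Let attractor_hutchinson : G `<=` T G.
Proof.
move=> x [a ae ax].
suff Gx : G (M *m x - a 0%N).
  by case: (ae 0%N) Gx => ->; [rewrite subr0; left|right].
exists (fun k => a k.+1) => [k|]; first exact: ae.
have -> : series (fun k => W ^+ k.+1 *m a k.+1) =
    fun m => M *m (series (fun k => W ^+ k.+1 *m a k) m.+1) - a 0%N.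
  apply/funext => m; rewrite /series /= big_nat_recl// expr1 mulmxDr MW.
  rewrite addrC addKr.
  rewrite mulmx_sumr; apply: eq_bigr => k _.
  by rewrite [in RHS]exprS -mulmxE -mulmxA MW.
apply: cvgB; last exact: cvg_cst.
apply/cvg_colP => i; apply: (@cvg_mulmx _ _ _ M (fun m => series _ m.+1) _ i).
by rewrite cvg_shiftS.
Qed.

(** A point of the intersection has an orbit under [y |-> M y - d], for suitable digits [d], that
    never leaves the intersection. The first [m] digits represent the point up to [W ^+ m] applied
    to an element of [B], hence up to [c * rho ^+ m]. *)
Lemma attractor_bigcap : G = \bigcap_m iter m T B.
Proof.
apply/seteqP; split => [x Gx m _|x Tx].
  elim: m x Gx => [|m IH] x; first exact: attractor_absorbing.
  by move=> /attractor_hutchinson[/IH|/IH]; [left|right].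
(* The sets being decreasing, one of the two digits suits all m at once. *)
pose P y := forall m, iter m T B y.
have digit y : exists d, P y -> [set 0; ivec e] d /\ P (M *m y - d).
  have [PMy|/existsNP[m0 Nm0]] := pselect (P (M *m y)).
    by exists 0 => _; split; [left|rewrite subr0].
  exists (ivec e) => Py; split; first by right.
  move=> m; have [|] := Py (maxn m m0).+1.
    by move/(iter_le (leq_maxr m m0)).
  by move/(iter_le (leq_maxl m m0)).
have [f fP] := choice digit.
pose xs k := iter k (fun y => M *m y - f y) x.
have Pxs k : P (xs k) by elim: k => [m|k /fP[]//]; exact: Tx.
exists (fun k => f (xs k)) => [k|]; first by have [] := fP _ (Pxs k).
have xE m : x = series (fun k => W ^+ k.+1 *m f (xs k)) m + W ^+ m *m xs m.
  elim: m => [|m {1}->].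
    by rewrite /series /= big_geq// add0r expr0 mul1mx.
  rewrite /series /= big_nat_recr//= -addrA -mulmxDr; congr (_ + _).
  by rewrite WS addrC subrK WM.
apply/cvg_colP => i; apply/cvgrPdist_le => eps eps0.
have /andP[rho0 rho1] := rho01.
have crho : geometric c rho @ \oo --> (0 : R).
  by apply: cvg_geometric; rewrite ger0_norm// ltW.
have /cvgr0Pnorm_le/(_ eps eps0) := crho.
apply: filterS => m cm.
rewrite {1}(xE m) [X in X - _]mxE [X in X - _]addrC addrK.
have := Pxs m 0%N m i => /le_trans; apply.
by apply: le_trans cm; exact: ler_norm.
Qed.

Lemma hutchinson_attractor : T G = G.
Proof.
apply/seteqP; split; last exact: attractor_hutchinson.
rewrite attractor_bigcap => x Tx m _; apply: iter_sub.
by case: Tx => Tx; [left|right]; exact: Tx.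
Qed.

End constant.

Lemma attractor_tile :
  (forall m, exists k, m = N *m k \/ m = N *m k + e) ->
  (forall k, N *m k <> e) -> (forall k, ternary N e k) -> is_tile G.
Proof.
move=> digits_cover e_odd tern.
have /andP[rho0 rho1] := rho01.
pose b := n%:R * C * \sum_j `|(e j ord0)%:~R| : R.
(* The sum of two lower bounds: [c_cube] asks for [n C <= c], and [c_digit] amounts to
   [rho b / (1 - rho) <= c]. *)
pose c := n%:R * C + rho * b / (1 - rho).
have C0 : 0 <= n%:R * C.
  (* The sign of [C] is read off an entry of [W ^+ 0], which exists only for positive [n]. *)
  case: (posnP n) => [->|n0]; first by rewrite mul0r.
  have := W_decay 0 (Ordinal n0) (Ordinal n0).
  by rewrite !expr0 mulr1 => /(le_trans (normr_ge0 _)) C0; rewrite mulr_ge0.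
have b0 : 0 <= b by rewrite mulr_ge0// sumr_ge0.
have c_cube : n%:R * C <= c.
  rewrite lerDl divr_ge0//; first by rewrite mulr_ge0// ltW.
  by rewrite subr_ge0 ltW.
have c_digit : rho * (c + b) <= c.
  have r1 : 1 - rho != 0 by rewrite subr_eq0 gt_eqF.
  have -> : rho * (c + b) = rho * (n%:R * C) + rho * b / (1 - rho).
    by rewrite /c; field.
  by rewrite lerD2r ler_piMl// ltW.
have GE := attractor_bigcap c_cube c_digit.
have mB := measurable_absorbing c.
have Bfin := lebesgue_absorbing c.
have mT m : measurable (iter m T (absorbing c)).
  by elim: m => //= m; exact: measurable_hutchinson.
have mG : measurable G by rewrite GE; exact: bigcapT_measurable.
have Gfin : (mu G < +oo)%E.
  apply: le_lt_trans Bfin; apply: le_measure; rewrite ?inE//.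
  by rewrite GE => x /(_ 0%N I).
have TG := hutchinson_attractor c_cube c_digit.
apply/eqP; rewrite eq_le; apply/andP; split.
  exact: lebesgue_self_affine_le1 tern.
rewrite GE; apply: lebesgue_self_affine_ge1 => //.
  exact: hutchinson_absorbing.
exact: unit_cube_absorbing.
Qed.
End attractor.

(** * Ternary expansions with respect to a companion matrix *)

(** For monic [p] of degree [k + 1], this is multiplication by [X] on coefficient vectors modulo
    [p]. *)
Lemma companion_mulE (R : nzRingType) k (p : seq R) (x : 'cV[R]_k.+1) i :
  (companion k.+1 p *m x) i ord0 =
  (if i == 0 :> nat then 0 else x (inord i.-1) ord0) - p`_i * x ord_max ord0.
Proof.
rewrite mxE big_ord_recr /= !mxE eqxx mulNr; congr (_ - _).
under eq_bigr => j _ do rewrite mxE /= ltn_eqF//.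
case: ifPn => [/eqP i0|i0].
  by rewrite big1// => j _; rewrite i0 mul0r.
have ik : (i.-1 < k)%N by case: i i0 => [[|i]].
rewrite (bigD1 (Ordinal ik))//= prednK ?lt0n// eqxx mul1r big1 ?addr0.
  congr (x _ _); apply/val_inj; rewrite /= inordK//.
  by case: i i0 ik => [[|i]] //= ? _ ?; lia.
move=> j ji; rewrite (_ : _ == _ = false) ?mul0r//; apply/eqP => ij.
by move/eqP : ji; apply; apply/val_inj; rewrite /= ij.
Qed.

Section digits.
Variables (k : nat) (p : seq int).
Hypothesis p0 : p`_0 = 2 \/ p`_0 = -2.
Local Notation N := (companion k.+1 p).
Local Notation e := (e1 int k.+1).

Lemma companion_digits_cover (m : 'cV[int]_k.+1) :
  exists x, m = N *m x \/ m = N *m x + e.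
Proof.
have [q [r [mE r01]]] : exists q r : int,
    m ord0 ord0 = - p`_0 * q + r /\ (r = 0 \/ r = 1).
  case: p0 => ->.
    exists (- (m ord0 ord0 %/ 2)%Z), (m ord0 ord0 %% 2)%Z; lia.
  exists (m ord0 ord0 %/ 2)%Z, (m ord0 ord0 %% 2)%Z; lia.
(* The first row of [N x = m - r e] gives [r], by parity, and the last coordinate [q] of [x]; the
   other rows then give the other coordinates. *)
pose x := \col_(j < k.+1) if j == k :> nat then q
  else m (inord j.+1) ord0 + p`_j.+1 * q.
exists x.
have -> : N *m x = m - r *: e.
  apply/colP => i; rewrite [LHS]companion_mulE !mxE eqxx.
  case: ifPn => [/eqP i0|i0].
    have -> : i = ord0 by exact/val_inj.
    by rewrite mE /= mulr1; ring.
  rewrite mulr0 subr0 inordK; last by case: i i0 => [[|i]] //= ? _; lia.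
  rewrite ifF; last by case: i i0 => [[|i]] //= ? _; lia.
  rewrite prednK ?lt0n// addrK; congr (m _ _).
  by apply/val_inj; rewrite /= inordK.
by case: r01 => ->; [left; rewrite scale0r subr0|right; rewrite scale1r subrK].
Qed.

Lemma companion_e_odd (x : 'cV[int]_k.+1) : N *m x <> e.
Proof.
move=> /colP/(_ ord0); rewrite [LHS]companion_mulE mxE /= sub0r.
by move: (x _ _) => q; case: p0 => ->; lia.
Qed.
End digits.

(** * Addition of ternary expansions with carries *)

Section carries.
Implicit Types (a x : seq int) (P : seq (seq int)).

(* Vectors are lists of coordinates, and a lists the coefficients of the
   polynomial but the leading one: this is N x + s e. *)
Definition companion_step a x (s : int) : seq int :=
  [seq (if i is j.+1 then x`_j else s) - a`_i * x`_(size a).-1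
    | i <- iota 0 (size a)].

(* The solution y of x = N y + s e when there is one, and junk otherwise: every
   use is checked by companion_step. *)
Definition companion_div a x (s : int) : seq int :=
  let t := ((x`_0 - s) %/ a`_0)%Z in
  rcons [seq x`_i - t * a`_i | i <- iota 1 (size a).-1] (- t).

Definition trits : seq int := [:: 0; 1; -1].

Definition add_head x (c : int) : seq int := (x`_0 + c) :: behead x.

(* vm_compute is strict, hence conditionals rather than boolean connectives. *)
Fixpoint ternary_search a n x : bool :=
  if x == nseq (size a) 0 then true else
  if n is m.+1 then
    has (fun s => let y := companion_div a x s in
      if companion_step a y s == x then ternary_search a m y else false) trits
  else false.

(* Adding a carry q in P to an expansion whose lowest digit is c yields a lowest
   digit s and a carry y again in P. *)
Definition carry_closed a P : bool :=
  all (fun q => all (fun c => has (fun s =>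
    let y := companion_div a (add_head q c) s in
    (companion_step a y s == add_head q c) && (y \in P)) trits) trits) P.

(** A certificate that the ternary vectors are stable under adding [e] and [- e]; [n] bounds the
    number of digits searched for each carry. *)
Definition carries a (P : seq (seq int)) n : bool :=
  [&& carry_closed a P, all (ternary_search a n) P,
   1 :: nseq (size a).-1 0 \in P & -1 :: nseq (size a).-1 0 \in P].

Definition l1_norm x : nat := foldr (fun c n => `|c| + n)%N 0%N x.

(** The state holds the carries found so far and those still to be processed. For constant term 2 or
    -2, an even first coordinate of [x] only allows the digit 0, while an odd one allows both 1 and
    -1. *)
Definition add_carry a (st : seq (seq int) * seq (seq int)) x :=
  let ys := [seq y <- [seq companion_div a x s | s <- trits] |
    has (fun s => companion_step a y s == x) trits] in
  if has (mem st.1) ys then st else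
  let y := foldr (fun y z => if (l1_norm y < l1_norm z)%N then y else z)
    (head [::] ys) ys in
  (y :: st.1, y :: st.2).

(* Whenever both digits are possible, the carry of least norm is preferred; that
   this terminates with a closed set is only known through carry_closed. *)
Fixpoint close_carries a n P (todo : seq (seq int)) : seq (seq int) :=
  if n is m.+1 then
    if todo is q :: todo' then
      let xs := [seq add_head q c | c <- trits] in
      let st := foldl (add_carry a) (P, todo') xs in
      close_carries a m st.1 st.2
    else P
  else P.

(** At most 60 carries are processed; that this suffices is part of what [carries] verifies
    afterwards. *)
Definition carry_set a : seq (seq int) :=
  let P := [seq c :: nseq (size a).-1 0 | c <- trits] in close_carries a 60 P P.

(** Constant term first, leading 1 omitted: six quadratics, then fourteen cubics, of which the last
    seven are [- p(- z)] for the first seven [p]. *)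
Definition expanding_coefs : seq (seq int) :=
  [:: [:: 2; 0]; [:: 2; 1]; [:: 2; -1]; [:: 2; 2]; [:: 2; -2]; [:: -2; 0];
      [:: 2; -1; -1]; [:: 2; 0; 0]; [:: 2; -1; 0]; [:: 2; 1; 1];
      [:: 2; -2; 0]; [:: 2; 0; 1]; [:: 2; 2; 2];
      [:: -2; -1; 1]; [:: -2; 0; 0]; [:: -2; -1; 0]; [:: -2; 1; -1];
      [:: -2; -2; 0]; [:: -2; 0; -1]; [:: -2; 2; -2]].

Lemma expanding_coefs_carries :
  all (fun a => carries a (carry_set a) 9) expanding_coefs.
Proof. by vm_compute. Qed.

End carries.

Section ternary_carries.
Variables (k : nat) (p : seq int) (a : seq int).
Hypothesis a_size : size a = k.+1.
Hypothesis pa : forall i, (i < k.+1)%N -> p`_i = a`_i.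
Local Notation N := (companion k.+1 p).
Local Notation e := (e1 int k.+1).

Let vec (x : seq int) : 'cV[int]_k.+1 := \col_i x`_i.

Let vec_step x y s : companion_step a y s == x -> vec x = N *m vec y + s *: e.
Proof.
move=> /eqP <-; apply/colP => i.
rewrite [RHS]mxE [X in X + _]companion_mulE !mxE.
rewrite (nth_map 0%N) ?size_iota a_size// nth_iota// add0n /=.
rewrite pa ?ltn_ord// addrAC; congr (_ - _).
case: i => [[|i] ik] /=; first by rewrite mulr1 add0r.
by rewrite inordK ?mulr0 ?addr0//; lia.
Qed.

Let vec_add_head x c : vec (add_head x c) = vec x + c *: e.
Proof.
apply/colP => i; rewrite !mxE; case: i => [[|i] ik] /=; first by rewrite mulr1.
by rewrite nth_behead mulr0 addr0.
Qed.

Let trits_le1 s : s \in trits -> `|s| <= 1.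
Proof. by rewrite !inE => /or3P[] /eqP ->. Qed.

Let le1_trits (s : int) : `|s| <= 1 -> s \in trits.
Proof. by case: s => [[|[|?]]|[|?]]. Qed.

Lemma ternary_searchP n x : ternary_search a n x -> ternary N e (vec x).
Proof.
have tern0 : ternary N e (vec (nseq (size a) 0)).
  rewrite (_ : vec _ = 0); first exact: ternary0.
  by apply/colP => i; rewrite !mxE nth_nseq; case: ifP.
elim: n x => [|n IH] x; rewrite /ternary_search -/ternary_search;
  case: ifP => [/eqP ->|_] //.
case/hasP => s st; case: ifP => // /vec_step -> /IH ty.
by apply: ternaryS => //; exact: trits_le1.
Qed.

Lemma carries_ternary P n : carries a P n -> forall x, ternary N e x.
Proof.
case/and4P => /allP closedP /allP ternP P1 PN1.
(* Schoolbook addition: closedness turns [s e + q] into [N q' + r e], where the carry [q'] is added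
   to the higher digits [t']. Once these are exhausted, the remaining carry is ternary by the
   search. *)
have addP t : ternary N e t -> forall q, q \in P -> ternary N e (t + vec q).
  elim=> [q /ternP/ternary_searchP|t' s _ IH s1 q qP]; first by rewrite add0r.
  have /allP/(_ _ (le1_trits s1)) := closedP q qP.
  case/hasP => r rt /andP[/vec_step E qrP].
  rewrite addrAC -addrA -vec_add_head E addrA -mulmxDr.
  by apply: ternaryS; [exact: IH|exact: trits_le1].
have vec1 c : vec (c :: nseq (size a).-1 0) = c *: e.
  apply/colP => i; rewrite !mxE; case: i => [[|i] ik] /=.
    by rewrite mulr1.
  by rewrite nth_nseq mulr0; case: ifP.
have add_e t (c : int) : ternary N e t -> ternary N e (t + c *: e).
  move=> tt; case: c => m.
    elim: m => [|m IH]; first by rewrite scale0r addr0.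
    by rewrite intS [1 + _]addrC scalerDl addrA -(vec1 1); exact: addP.
  rewrite NegzE; elim: m => [|m IH]; first by rewrite -vec1; exact: addP.
  rewrite intS opprD [_ + - _]addrC scalerDl addrA -(vec1 (-1)).
  exact: addP.
(* A vector supported on its first [m + 1] coordinates is [N y + x_0 e], where [y] is [x] shifted by
   one place. The last coordinate of [y] is 0, so [N] merely shifts it back; the multiple of [e] is
   then added one unit at a time. *)
suff supp m (x : 'cV[int]_k.+1) : (m <= k.+1)%N ->
    (forall i : 'I_k.+1, (m <= i)%N -> x i ord0 = 0) -> ternary N e x.
  by move=> x; apply: (supp k.+1) => // i; rewrite leqNgt ltn_ord.
elim: m x => [|m IH] x mk x0.
  rewrite (_ : x = 0); first exact: ternary0.
  by apply/colP => i; rewrite mxE x0.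
pose y : 'cV[int]_k.+1 :=
  \col_i if (i.+1 < k.+1)%N then x (inord i.+1) ord0 else 0.
have -> : x = N *m y + 0 *: e + x ord0 ord0 *: e.
  apply/colP => i; rewrite [RHS]mxE [X in X + _]mxE.
  rewrite [X in X + _ + _]companion_mulE !mxE.
  rewrite /= ltnn mulr0 subr0 mul0r addr0; case: ifPn => [/eqP i0|i0].
    by rewrite mulr1 add0r; congr (x _ _); exact/val_inj.
  rewrite mulr0 addr0 inordK; last by case: i i0 => [[|i]] //= ? _; lia.
  rewrite prednK ?lt0n// ltn_ord; congr (x _ _).
  by apply/val_inj; rewrite /= inordK.
apply/add_e/ternaryS; last by rewrite normr0.
apply: IH => [|i mi]; first exact: ltnW.
by rewrite mxE; case: ifP => // ik; apply: x0; rewrite inordK.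
Qed.

End ternary_carries.

(** * Expanding polynomials *)

Section decay.
Variables (K : numFieldType) (n m : nat) (A W : 'M[K]_n).
Hypothesis WA : W *m A = 1%:M.
Implicit Type X : 'M[K]_(n, m).

(** The linear factors are removed one at a time. With [Y = A X - z X], one has
    [z W^(k+1) X = W^k X - W^(k+1) Y], where [Y] is covered by induction and [1 / |z| < rho]. This
    avoids Jordan forms. *)
Lemma power_decay (rho : K) (zs : seq K) X : 0 < rho ->
  {in zs, forall z, 1 < rho * `|z|} ->
  foldl (fun Y z => A *m Y - z *: Y) X zs = 0 ->
  exists2 C, 0 <= C & forall k i j, `|(W ^+ k *m X) i j| <= C * rho ^+ k.
Proof.
move=> rho0; elim: zs X => [|z zs IH] X zs1 /= X0.
  by exists 0 => // k i j; rewrite X0 mulmx0 mxE normr0 mul0r.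
have [|C1 C10 HC1] := IH _ _ X0.
  by move=> y yzs; apply: zs1; rewrite inE yzs orbT.
have z1 : 0 < rho * `|z| - 1 by rewrite subr_gt0 zs1// mem_head.
have z0 : 0 < `|z|.
  by rewrite -(pmulr_rgt0 _ rho0) (lt_trans ltr01)// zs1 ?mem_head.
pose S := \sum_i \sum_j `|X i j|.
(* The first summand makes [C + C1 rho <= |z| C rho], as the induction on [k] needs; [S] settles
   [k = 0]. *)
pose C := C1 * rho / (rho * `|z| - 1) + S.
have S0 : 0 <= S by rewrite sumr_ge0// => i _; rewrite sumr_ge0.
have C0 : 0 <= C by rewrite addr_ge0// divr_ge0// ?mulr_ge0// ltW.
exists C => // k i j; elim: k => [|k IHk].
  rewrite expr0 expr0 mulr1 mul1mx (le_trans (y := S))//.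
    rewrite /S (bigD1 i)//= (bigD1 j)//= -addrA lerDl.
    by rewrite addr_ge0 ?sumr_ge0// => ? _; rewrite sumr_ge0.
  by rewrite lerDr divr_ge0// ?mulr_ge0// ltW.
have E : z *: (W ^+ k.+1 *m X) = W ^+ k *m X - W ^+ k.+1 *m (A *m X - z *: X).
  have WAX : W ^+ k.+1 *m (A *m X) = W ^+ k *m X.
    by rewrite exprSr -mulmxE -mulmxA (mulmxA W) WA mul1mx.
  by rewrite mulmxBr WAX -scalemxAr opprB addrCA subrr addr0.
rewrite -(ler_pM2l z0) -normrM.
have -> : z * (W ^+ k.+1 *m X) i j =
    (W ^+ k *m X) i j - (W ^+ k.+1 *m (A *m X - z *: X)) i j.
  by have := congr1 (fun B : 'M[K]_(n, m) => B i j) E; rewrite !mxE.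
rewrite (le_trans (ler_normB _ _))// (le_trans (lerD IHk (HC1 _ _ _)))//.
rewrite exprS !mulrA -mulrDl ler_wpM2r ?exprn_ge0//; first exact: ltW.
have -> : `|z| * C * rho = C + C * (rho * `|z| - 1) by ring.
rewrite lerD2l mulrDl divfK ?gt_eqF// lerDl mulr_ge0//; exact: ltW.
Qed.

End decay.

(** Through this identity the Cayley-Hamilton theorem supplies the hypothesis of [power_decay]. *)
Lemma horner_mx_foldl (K : fieldType) n m (A : 'M[K]_n.+1) (zs : seq K)
    (X : 'M[K]_(n.+1, m)) :
  foldl (fun Y z => A *m Y - z *: Y) X zs =
  horner_mx A (\prod_(z <- zs) ('X - z%:P)) *m X.
Proof.
elim: zs X => [|z zs IH] X /=; first by rewrite big_nil rmorph1 mul1mx.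
rewrite IH big_cons mulrC rmorphM -mulmxE -mulmxA rmorphB /=.
by rewrite horner_mx_X horner_mx_C mulmxBl mul_scalar_mx.
Qed.

Lemma char_poly_companion (S : comNzRingType) d (q : {poly S}) :
  q \is monic -> size q = d.+1 -> char_poly (companion d q) = q.
Proof.
move=> qm qd; have -> : d = (size q).-1 by rewrite qd.
rewrite companion_companionmx -[RHS]companionmxK// /char_poly -det_tr.
congr (\det _); apply/matrixP => i j.
by rewrite !mxE [i == j]eq_sym.
Qed.

Lemma map_companion (S : nzRingType) d (p : {poly int}) :
  map_mx intr (companion d p) = companion d (map_poly intr p) :> 'M[S]_d.
Proof.
apply/matrixP => i j; rewrite !mxE; case: ifP => _.
  by rewrite coef_map rmorphN.
by rewrite rmorph_nat.
Qed.

Section expanding_roots.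
Variables (R : realType) (p : {poly int}).
Hypothesis p_monic : p \is monic.
Hypothesis p_expanding : expanding R p.
Local Notation K := R[i].

Let pK : {poly K} := map_poly intr p.

Lemma expanding_split : exists2 zs : seq K, {in zs, forall z, 1 < `|z|} &
  pK = \prod_(z <- zs) ('X - z%:P).
Proof.
have [zs pE] := closed_field_poly_normal pK.
have pK1 : lead_coef pK = 1 by apply/monicP/monic_map.
move: pE; rewrite pK1 scale1r => pE; exists zs => // z zzs.
by apply: p_expanding; rewrite -/pK pE root_prod_XsubC.
Qed.

Lemma expanding_rho (zs : seq K) : {in zs, forall z, 1 < `|z|} ->
  exists2 rho : R, 0 < rho < 1 & {in zs, forall z, 1 < rho%:C%C * `|z|}.
Proof.
elim: zs => [|z zs IH] zs1; first by exists 2^-1 => //; lra.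
have [|r /andP[r0 r1] Hr] := IH.
  by move=> y yzs; apply: zs1; rewrite inE yzs orbT.
have := zs1 z (mem_head _ _); rewrite normc_def -[1]/(1%:C%C) ltcR.
set t := Num.sqrt _ => t1.
have t0 : 0 < t by lra.
(* The midpoint of [1 / t] and 1, for which [s t = (t + 1) / 2]. *)
pose s := (1 + t^-1) / 2.
have tV1 : t^-1 < 1 by rewrite invf_lt1.
have tV0 : 0 < t^-1 by rewrite invr_gt0.
have s01 : 0 < s < 1 by rewrite /s; lra.
have st : 1 < s * t.
  have -> : s * t = (t + 1) / 2 by rewrite /s; field; rewrite gt_eqF.
  by lra.
(* A polynomial substitute for the maximum of [r] and [s]: it dominates both and stays below 1. *)
pose rho := 1 - (1 - r) * (1 - s).
have rhor : r <= rho by rewrite /rho; nra.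
have rhos : s <= rho by rewrite /rho; nra.
have rho1 : rho < 1 by rewrite /rho; nra.
exists rho; first by lra.
move=> y; rewrite inE => /orP[/eqP->|yzs].
  rewrite normc_def -/t -rmorphM; change (1%:C%C < (rho * t)%:C%C).
  by rewrite ltcR; nra.
by apply: lt_le_trans (Hr _ yzs) _; rewrite ler_wpM2r// lecR.
Qed.

End expanding_roots.

(** * Inequalities for the coefficients of expanding polynomials *)

Section coefficients.
Variables (R : realType) (p : {poly int}).
Hypothesis p_expanding : expanding R p.

Let pR : {poly R} := map_poly intr p.

Lemma expanding_real_root (x : R) : `|x| <= 1 -> ~~ root pR x.
Proof.
move=> x1; apply/negP => px.
have : root (map_poly intr p : {poly R[i]}) x%:C%C.
  rewrite (_ : map_poly intr p = map_poly (real_complex R) pR) ?fmorph_root//.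
  by rewrite -map_poly_comp; apply: eq_map_poly => z /=; rewrite rmorph_int.
move=> /p_expanding; rewrite normc_def /= expr0n addr0 sqrtr_sqr.
by rewrite -[1]/(1%:C%C) ltcR ltNge x1.
Qed.

Lemma no_root_sign (q : {poly R}) (a b : R) :
  (forall x, a <= x <= b -> ~~ root q x) -> a <= b -> 0 < q.[a] * q.[b].
Proof.
move=> q0 ab.
suff sgn (q' : {poly R}) : (forall x, a <= x <= b -> ~~ root q' x) ->
    0 < q'.[a] -> 0 < q'.[b].
  have := q0 a; rewrite lexx ab => /(_ isT); rewrite /root neq_lt => /orP[] qa.
    rewrite -mulrNN mulr_gt0// -?hornerN; first by rewrite hornerN oppr_gt0.
    by apply: sgn; [move=> x /q0; rewrite rootN|rewrite hornerN oppr_gt0].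
  by rewrite mulr_gt0// sgn.
move=> q'0 qa; rewrite ltNge; apply/negP => qb.
have [|x xab] := @poly_ivt R (- q') a b ab.
  by rewrite !hornerN oppr_le0 oppr_ge0 qb ltW.
by rewrite rootN; apply/negP/q'0.
Qed.

Lemma expanding_sign1 : 0 < p.[0] * p.[1].
Proof.
have := @no_root_sign pR 0 1.
rewrite -(ltr_int R) rmorphM /= -!horner_map /= rmorph0 rmorph1.
apply => // x /andP[x0 x1]; apply: expanding_real_root.
by rewrite ler_norml; lra.
Qed.

Lemma expanding_signN1 : 0 < p.[0] * p.[-1].
Proof.
have := @no_root_sign pR (-1) 0.
rewrite -(ltr_int R) rmorphM /= -!horner_map /= rmorph0 rmorphN1 mulrC.
apply => // x /andP[x0 x1].
by apply: expanding_real_root => //; rewrite ler_norml; lra.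
Qed.
End coefficients.

Section quadratic_factor.
Variables (R : realType) (p : {poly int}) (r s t : R).
Hypothesis p_expanding : expanding R p.
Hypothesis pE : map_poly intr p =
  ('X - r%:P) * ('X ^+ 2 - s *: 'X + t%:P) :> {poly R}.
Local Notation K := R[i].

(** Here [s] and [t] are the sum and the product of the roots of the quadratic factor; the last two
    bounds say that this factor has the same sign at 0 as at 1 and at -1. *)
Lemma expanding_quadratic_factor :
  [/\ 1 < `|r|, 1 < `|t|, 0 < t * (1 - s + t) & 0 < t * (1 + s + t)].
Proof.
pose g : {poly R} := 'X ^+ 2 - s *: 'X + t%:P.
have root_factor x : root (map_poly intr p) x = (x == r) || root g x.
  by rewrite pE rootM root_XsubC.
have r1 : 1 < `|r|.
  rewrite ltNge; apply/negP => /(expanding_real_root p_expanding).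
  by rewrite root_factor eqxx.
have g0 x : `|x| <= 1 -> ~~ root g x.
  move=> /(expanding_real_root p_expanding).
  by rewrite root_factor negb_or => /andP[].
have gE x : g.[x] = x ^+ 2 - s * x + t by rewrite !hornerE.
split => //; last 2 first.
- have -> : t * (1 - s + t) = g.[0] * g.[1] by rewrite !gE; ring.
  apply: no_root_sign => // x /andP[x0 x1]; apply: g0.
  by rewrite ler_norml; lra.
- have -> : t * (1 + s + t) = g.[-1] * g.[0] by rewrite !gE; ring.
  apply: no_root_sign => // x /andP[x0 x1]; apply: g0.
  by rewrite ler_norml; lra.
(* t is the product of the complex roots z and s - z of the quadratic factor. *)
pose sK := s%:C%C; pose tK := t%:C%C.
have pKE (z : K) : z ^+ 2 - sK * z + tK = 0 -> 1 < `|z|.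
  move=> z0; apply: p_expanding.
  have -> : map_poly intr p =
      map_poly (real_complex R) (map_poly intr p : {poly R}) :> {poly K}.
    by rewrite -map_poly_comp; apply: eq_map_poly => y /=; rewrite rmorph_int.
  rewrite pE rmorphM /= rootM; apply/orP; right.
  rewrite /root rmorphD rmorphB /= map_polyXn map_polyZ map_polyX map_polyC.
  by rewrite !hornerE /= z0.
have [z] := @solve_monicpoly K 2 (fun i => [:: - tK; sK]`_i) isT.
rewrite !big_ord_recr big_ord0 /= add0r expr0 mulr1 expr1 => z2.
have z1 : 1 < `|z| by apply: pKE; rewrite z2; ring.
have z'1 : 1 < `|sK - z|.
  by apply: pKE; rewrite sqrrB z2; ring: z2.
have : 1 < `|tK|.
  have -> : tK = z * (sK - z) by rewrite mulrBr -expr2 z2; ring.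
  by rewrite normrM; apply: mulr_egt1.
rewrite normc_def /= expr0n addr0 sqrtr_sqr.
by change (1%:C%C < `|t|%:C%C -> 1 < `|t|); rewrite ltcR.
Qed.

(** The Schur-Cohn inequality [|a_0 a_2 - a_1| < a_0^2 - 1], with the coefficients expressed by [r],
    [s] and [t]. *)
Lemma expanding_cubic_bound :
  `|t * (r ^+ 2 - 1) + r * s * (t - 1)| < r ^+ 2 * t ^+ 2 - 1.
Proof.
have [r1 t1 g1 gN1] := expanding_quadratic_factor.
(* The signs at 1 and -1 give [|s| <= |1 + t|], to be multiplied by [|t - 1|]. *)
have st : `|s| * `|t - 1| <= `|t| ^+ 2 - 1.
  have [t0|t0] := ltP 0 t.
    move: g1 gN1 t1; rewrite !pmulr_rgt0// (gtr0_norm t0) => g1 gN1 t1.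
    have s1 : `|s| <= 1 + t by rewrite ler_norml; lra.
    rewrite (ger0_norm (_ : 0 <= t - 1)); last lra.
    by rewrite [leRHS](_ : _ = (1 + t) * (t - 1)); [apply: ler_wpM2r; lra|ring].
  have {}t0 : t < 0.
    rewrite lt_neqAle t0 andbT; apply/eqP => tE.
    by move: t1; rewrite tE normr0; lra.
  move: g1 gN1 t1; rewrite !nmulr_rgt0// (ltr0_norm t0) => g1 gN1 t1.
  have s1 : `|s| <= - t - 1 by rewrite ler_norml; lra.
  rewrite (ltr0_norm (_ : t - 1 < 0)); last lra.
  rewrite [leRHS](_ : _ = (- t - 1) * - (t - 1)); last by ring.
  by apply: ler_wpM2r; lra.
rewrite (le_lt_trans (ler_normD _ _))// !normrM.
have r21 : 1 < `|r| ^+ 2 by nra.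
rewrite -(real_normK (num_real r)) -(real_normK (num_real t)).
rewrite (ger0_norm (_ : 0 <= `|r| ^+ 2 - 1)); last lra.
rewrite -mulrA; move: st; set u := `|s| * _ => st.
(* The difference of the two sides when st is an equality. *)
have : 0 < (`|t| - 1) * (`|r| * `|t| - 1) * (`|r| - 1).
  rewrite !mulr_gt0//; [lra|nra|lra].
nra.
Qed.
End quadratic_factor.

(** * Inverse powers of an expanding companion matrix *)

Section expanding_companion.
Variables (R : realType) (d : nat) (p : {poly int}).
Hypotheses (p_monic : p \is monic) (p_deg : size p = d.+2).
Hypothesis p_expanding : expanding R p.
Local Notation M := (map_mx intr (companion d.+1 p) : 'M[R]_d.+1).

Lemma expanding_companion_unit : M \in unitmx.
Proof.
have : ~~ root (map_poly intr p : {poly R}) 0.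
  by apply: expanding_real_root => //; rewrite normr0.
have mp : (map_poly intr p : {poly R}) \is monic by exact: monic_map.
have sp : size (map_poly intr p : {poly R}) = d.+2.
  by rewrite size_map_poly_id0// (monicP p_monic) oner_eq0.
rewrite unitmxE unitfE; apply: contra => /eqP det0.
rewrite /root horner_coef0 -(char_poly_companion mp sp) -map_companion.
by rewrite char_poly_det det0 mulr0.
Qed.

(** Over the complex numbers [p] splits and annihilates [M], so [power_decay] applies with [X = 1];
    its constant is nonnegative, hence real, and the bound descends to the reals. *)
Lemma expanding_companion_decay :
  exists C rho : R, 0 < rho < 1 /\
    forall k i j, `|(invmx M ^+ k) i j| <= C * rho ^+ k.
Proof.
pose toK := map_mx (real_complex R) : 'M[R]_d.+1 -> 'M[R[i]]_d.+1.
have [zs zs1 pE] := expanding_split p_monic p_expanding.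
have [rho rho01 zsrho] := expanding_rho zs1.
have WM : toK (invmx M) *m toK M = 1%:M.
  by rewrite -map_mxM mulVmx ?map_mx1//; exact: expanding_companion_unit.
have toKX k : toK (invmx M) ^+ k = toK (invmx M ^+ k).
  by rewrite /toK -rmorphXn.
have toKM : toK M = companion d.+1 (map_poly intr p).
  rewrite -map_companion; apply/matrixP => i j; rewrite !mxE.
  by case: ifP => _; rewrite rmorph_int.
have pM0 : horner_mx (toK M) (map_poly intr p) = 0.
  rewrite -(@char_poly_companion _ d.+1 (map_poly intr p)).
  - by rewrite toKM; exact: Cayley_Hamilton.
  - exact: monic_map.
  - by rewrite size_map_poly_id0// (monicP p_monic) oner_eq0.
have /andP[rho0 rho1] := rho01.
have [|||C C0 HC] := @power_decay _ _ _ _ _ WM rho%:C%C zs 1%:M.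
- by change (0%:C%C < rho%:C%C); rewrite ltcR.
- exact: zsrho.
- by rewrite horner_mx_foldl -pE pM0 mul0mx.
exists (complex.Re C), rho; split => // k i j.
have := HC k i j; rewrite toKX mulmx1 mxE normc_def /= expr0n addr0 sqrtr_sqr.
rewrite -(RRe_real (ger0_real C0)) -rmorphXn -rmorphM lecR.
by apply.
Qed.

End expanding_companion.

(** * Enumeration of the expanding polynomials *)

Section coefficient_bounds.
Variables (R : realType) (p : {poly int}).
Hypotheses (p_monic : p \is monic) (p_expanding : expanding R p).
Hypothesis p_free : p`_0 = 2 \/ p`_0 = -2.

Lemma expanding_quadratic : size p = 3%N -> [:: p`_0; p`_1] \in expanding_coefs.
Proof.
move=> p3; have p2 : p`_2 = 1 by have := monicP p_monic; rewrite lead_coefE p3.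
have := expanding_sign1 p_expanding; have := expanding_signN1 p_expanding.
have -> : p.[1] = p`_0 + p`_1 + 1.
  by rewrite horner_coef p3 !big_ord_recr big_ord0 /= p2; ring.
have -> : p.[-1] = p`_0 - p`_1 + 1.
  by rewrite horner_coef p3 !big_ord_recr big_ord0 /= p2; ring.
rewrite horner_coef0; case: p_free => ->; move: p`_1 => b H1 H2.
  have : b = 0 \/ b = 1 \/ b = -1 \/ b = 2 \/ b = -2 by lia.
  by case=> [|[|[|[|]]]] ->.
by have -> : b = 0 by lia.
Qed.

Lemma expanding_cubic_coef_bound : size p = 4%N -> `|p`_0 * p`_2 - p`_1| < 3.
Proof.
move=> p4; have p3 : p`_3 = 1 by have := monicP p_monic; rewrite lead_coefE p4.
pose a : R := (p`_2)%:~R; pose b : R := (p`_1)%:~R; pose c : R := (p`_0)%:~R.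
pose f (x : R) := x ^+ 3 + a * x ^+ 2 + b * x + c.
have fE x : (map_poly intr p).[x] = f x.
  rewrite horner_coef size_map_poly_id0 ?p4 ?(monicP p_monic) ?oner_eq0//.
  by rewrite !big_ord_recr big_ord0 /= !coef_map /= p3 /f /a /b /c; ring.
have [r fr] : exists r, f r = 0.
  (* Large enough for the cube to dominate the other terms at [T] and [- T], which gives a sign
     change. *)
  pose T := 3 + `|a| + `|b|.
  have aT : `|a| <= T - 3 by rewrite /T; have := normr_ge0 b; lra.
  have bT : `|b| <= T - 3 by rewrite /T; have := normr_ge0 a; lra.
  have cT : `|c| <= 2.
    rewrite /c ler_norml.
    by case: p_free => ->; apply/andP; split; lra.
  have T3 : 3 <= T by have := normr_ge0 a; lra.
  move: aT bT cT; rewrite !ler_norml => /andP[a0 a1] /andP[b0 b1] /andP[c0 c1].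
  have fT : 0 <= f T by rewrite /f; nra.
  have fNT : f (- T) <= 0 by rewrite /f; nra.
  have [||r _] := @poly_ivt R (map_poly intr p) (- T) T.
  - by lra.
  - by rewrite !fE fT fNT.
  - by rewrite /root fE => /eqP; exists r.
(* Obtained from the division of [f] by [X - r]. *)
pose s := - a - r; pose t := b - r * s.
have cE : c = - (r * t) by rewrite /t /s; move: fr; rewrite /f; lra.
have aE : a = - (r + s) by rewrite /s; ring.
have bE : b = r * s + t by rewrite /t; ring.
have pE : map_poly intr p =
    ('X - r%:P) * ('X ^+ 2 - s *: 'X + t%:P) :> {poly R}.
  transitivity ('X ^+ 3 + a *: 'X ^+ 2 + b *: 'X + c%:P).
    apply/polyP => i; rewrite coef_map /= !coefE.
    case: i => [|[|[|[|i]]]] /=; rewrite ?p3 ?(mulr0, mulr1, add0r, addr0)//.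
    by rewrite nth_default// p4.
  by rewrite -!mul_polyC aE bE cE !(polyCN, polyCD, polyCM); ring.
have := expanding_cubic_bound p_expanding pE.
have -> : t * (r ^+ 2 - 1) + r * s * (t - 1) = c * a - b.
  by rewrite cE /s /t /s; ring.
have -> : r ^+ 2 * t ^+ 2 = c ^+ 2 by rewrite cE; ring.
have -> : c ^+ 2 = 4 by rewrite /c; case: p_free => ->; ring.
rewrite /a /b /c -rmorphM -rmorphB -intr_norm => H.
by rewrite -(ltr_int R); lra.
Qed.

Lemma expanding_cubic :
  size p = 4%N -> [:: p`_0; p`_1; p`_2] \in expanding_coefs.
Proof.
move=> p4; have p3 : p`_3 = 1 by have := monicP p_monic; rewrite lead_coefE p4.
have := expanding_sign1 p_expanding; have := expanding_signN1 p_expanding.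
have := expanding_cubic_coef_bound p4.
have -> : p.[1] = p`_0 + p`_1 + p`_2 + 1.
  by rewrite horner_coef p4 !big_ord_recr big_ord0 /= p3; ring.
have -> : p.[-1] = p`_0 - p`_1 + p`_2 - 1.
  by rewrite horner_coef p4 !big_ord_recr big_ord0 /= p3; ring.
rewrite horner_coef0; case: p_free => ->; move: p`_1 p`_2 => b a H1 H2 H3.
  (* The integer solutions of the two sign conditions and the Schur-Cohn bound. *)
  have : (b = -1 /\ a = -1) \/ (b = 0 /\ a = 0) \/ (b = -1 /\ a = 0) \/
    (b = 1 /\ a = 1) \/ (b = -2 /\ a = 0) \/ (b = 0 /\ a = 1) \/
    (b = 2 /\ a = 2) by lia.
  by do 6?[case=> [[-> ->]//|]]; case=> -> ->.
have : (b = -1 /\ a = 1) \/ (b = 0 /\ a = 0) \/ (b = -1 /\ a = 0) \/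
  (b = 1 /\ a = -1) \/ (b = -2 /\ a = 0) \/ (b = 0 /\ a = -1) \/
  (b = 2 /\ a = -2) by lia.
by do 6?[case=> [[-> ->]//|]]; case=> -> ->.
Qed.

End coefficient_bounds.

Lemma expanding_tile (R : realType) (k : nat) (p : {poly int}) (a : seq int) :
  p \is monic -> size p = k.+2 -> expanding R p -> p`_0 = 2 \/ p`_0 = - 2 ->
  size a = k.+1 -> (forall i, (i < k.+1)%N -> p`_i = a`_i) ->
  a \in expanding_coefs ->
  is_tile (attractor (map_mx intr (companion k.+1 p) : 'M[R]_k.+1)
    [set 0; e1 R k.+1]).
Proof.
move=> p_monic p_deg p_exp p_free a_size pa aL.
have [C [rho [rho01 dec]]] := expanding_companion_decay p_monic p_deg p_exp.
have -> : e1 R k.+1 = ivec R (e1 int k.+1).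
  by apply/matrixP => i j; rewrite !mxE rmorph_nat.
have unitM := expanding_companion_unit p_monic p_deg p_exp.
apply: (attractor_tile unitM rho01 dec).
- exact: companion_digits_cover.
- exact: companion_e_odd.
- exact: (carries_ternary a_size pa (allP expanding_coefs_carries _ aL)).
Qed.

Theorem proposition4 (R : realType) (d : nat) (p : {poly int})
    (d23 : d = 2%N \/ d = 3%N)
    (p_monic : p \is monic) (p_deg : size p = d.+1)
    (p_expanding : expanding R p)
    (p_free : p`_0 = 2 \/ p`_0 = - 2) :
  is_tile (attractor (map_mx intr (companion d p) : 'M[R]_d) [set 0; e1 R d]).
Proof.
case: d23 => dE; subst d.
  apply: (@expanding_tile R 1 p [:: p`_0; p`_1]) => //.
    by case=> [|[|]].
  exact: expanding_quadratic p_expanding _ _.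
apply: (@expanding_tile R 2 p [:: p`_0; p`_1; p`_2]) => //.
  by case=> [|[|[|]]].
exact: expanding_cubic p_expanding _ _.
Qed.
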